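(* Let $\Gamma=\{\sim_{(1,1)},\sim_{(2,2)}\}$. The problem $\mathrm{DataSat}(\mathrm{eFO}^{3},2,\Gamma)$ is undecidable.
   Context: Let $\Sigma$ be a finite set of unary predicate symbols and $D\ge 0$. A $D$-data structure over $\Sigma$ is $\mathfrak{A}=(A,(P_\sigma)_{\sigma\in\Sigma},f_1,\dots,f_D)$ with $A$ nonempty finite, $P_\sigma\subseteq A$, $f_i:A\to\mathbb{N}$; $\mathrm{Data}(D,\Sigma)$ is the set of these. $\sim_{(i,j)}$ is interpreted by $a\sim_{(i,j)}b$ iff $f_i(a)=f_j(b)$. For a set $\Gamma$ of such symbols, $\mathrm{dFO}[D,\Sigma,\Gamma]$ is first-order logic with atoms $\sigma(x)$, $x\sim y$ ($\sim\in\Gamma$), $x=y$, closed under $\vee,\neg,\exists$. Data graph (relative to $\Gamma$): vertices $A\times\{1,\dots,D\}$, directed edge $(a,i)\to(b,j)$ iff either $a=b$ and $i\ne j$, or $\sim_{(i,j)}\in\Gamma$ and $f_i(a)=f_j(b)$. $B_r(a)$ = vertices $(b,j)$ at directed distance $\le r$ from $(a,i)$ for some $i$. The $r$-view $\mathfrak{A}|^r_a$: universe $\{b:(b,i)\in B_r(a)\text{ for some }i\}$, restricted predicates, $i$-th value of $b$ is $f_i(b)$ if $(b,i)\in B_r(a)$, else a fresh value (pairwise distinct, not among values of $\mathfrak{A}$). $\langle\psi\rangle^r_x$ (for $\psi\in\mathrm{dFO}[D,\Sigma,\Gamma]$ with at most $x$ free) holds under $I$ iff $\mathfrak{A}|^r_{I(x)}\models_I\psi$.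 $\mathrm{eFO}[D,\Sigma,\Gamma,r]$: $\varphi::=\langle\psi\rangle^r_x\mid x=y\mid\neg(x=y)\mid\exists x.\varphi\mid\varphi\vee\varphi\mid\varphi\wedge\varphi$, no restriction on quantifiers inside $\psi$. $\mathrm{DataSat}(\mathrm{eFO}^r,D,\Gamma)$: given finite $\Sigma$ and a sentence $\varphi\in\mathrm{eFO}[D,\Sigma,\Gamma,r]$, is there $\mathfrak{A}\in\mathrm{Data}(D,\Sigma)$ with $\mathfrak{A}\models\varphi$? *)

(* Defs.v *)
From mathcomp Require Import all_boot.
From Stdlib Require Cantor.

Set Implicit Arguments.
Unset Strict Implicit.
Unset Printing Implicit Defensive.

(* Data values are indexed by 'I_D = {0, ..., D-1} instead of {1, ..., D}, so *)
(* the relation symbol ~_(i,j) is the pair (i-1, j-1) : 'I_D * 'I_D.          *)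

(* Nonemptiness of the universe A is required in DataSat. *)
Record data (D : nat) (Sigma A : finType) := Data {
  dpred : Sigma -> {set A};
  dval : 'I_D -> A -> nat }.

Inductive dFO (D : nat) (Sigma : finType) (Gamma : {set 'I_D * 'I_D}) : Type :=
| dPred of Sigma & nat
| dSim (i j : 'I_D) of (i, j) \in Gamma & nat & nat
| dEq of nat & nat
| dOr of dFO Sigma Gamma & dFO Sigma Gamma
| dNot of dFO Sigma Gamma
| dEx of nat & dFO Sigma Gamma.

Fixpoint dfv (D : nat) (Sigma : finType) (Gamma : {set 'I_D * 'I_D})
    (psi : dFO Sigma Gamma) : seq nat :=
  match psi with
  | dPred _ x => [:: x]
  | dSim _ _ _ x y => [:: x; y]
  | dEq x y => [:: x; y]
  | dOr p q => dfv p ++ dfv q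
  | dNot p => dfv p
  | dEx x p => [seq y <- dfv p | y != x]
  end.

Fixpoint dsat (D : nat) (Sigma : finType) (Gamma : {set 'I_D * 'I_D})
    (A : finType) (str : data D Sigma A) (I : nat -> A)
    (psi : dFO Sigma Gamma) : bool :=
  match psi with
  | dPred s x => I x \in dpred str s
  | dSim i j _ x y => dval str i (I x) == dval str j (I y)
  | dEq x y => I x == I y
  | dOr p q => dsat str I p || dsat str I q
  | dNot p => ~~ dsat str I p
  | dEx x p => [exists a, dsat str [eta I with x |-> a] p]
  end.

Definition data_edge (D : nat) (Sigma A : finType) (Gamma : {set 'I_D * 'I_D})
    (str : data D Sigma A) : rel (A * 'I_D) :=
  fun u v => (u.1 == v.1) && (u.2 != v.2)
    || ((u.2, v.2) \in Gamma) && (dval str u.2 u.1 == dval str v.2 v.1).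

Definition dist_le (V : finType) (e : rel V) (r : nat) (u v : V) : bool :=
  [exists k : 'I_r.+1, exists p : k.-tuple V, path e u p && (last u p == v)].

Definition ball (D : nat) (Sigma A : finType) (Gamma : {set 'I_D * 'I_D})
    (str : data D Sigma A) (r : nat) (a : A) : {set A * 'I_D} :=
  [set v | [exists i : 'I_D, dist_le (data_edge Gamma str) r (a, i) v]].

Definition view_dom (D : nat) (Sigma A : finType) (Gamma : {set 'I_D * 'I_D})
    (str : data D Sigma A) (r : nat) (a : A) : {set A} :=
  [set b | [exists i : 'I_D, (b, i) \in ball Gamma str r a]].

(* Above every value of str, and injective in v. *)
Definition fresh (D : nat) (Sigma A : finType) (str : data D Sigma A)
    (v : A * 'I_D) : nat :=
  (\max_(w : A * 'I_D) dval str w.2 w.1).+1 + enum_rank v.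

Definition view (D : nat) (Sigma A : finType) (Gamma : {set 'I_D * 'I_D})
    (str : data D Sigma A) (r : nat) (a : A) :
    data D Sigma {b : A | b \in view_dom Gamma str r a} :=
  {| dpred := fun s => [set b | val b \in dpred str s];
     dval := fun i b => if (val b, i) \in ball Gamma str r a
                        then dval str i (val b) else fresh str (val b, i) |}.

(* The radius r only affects the semantics of eLoc. *)
Inductive eFO (D : nat) (Sigma : finType) (Gamma : {set 'I_D * 'I_D})
    (r : nat) : Type :=
| eLoc (x : nat) (psi : dFO Sigma Gamma) of all (pred1 x) (dfv psi)
| eEq of nat & nat
| eNeq of nat & nat
| eEx of nat & eFO Sigma Gamma r
| eOr of eFO Sigma Gamma r & eFO Sigma Gamma r
| eAnd of eFO Sigma Gamma r & eFO Sigma Gamma r.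

(* x is free in <psi>_x even when psi is closed: the view depends on I x. *)
Fixpoint efv (D : nat) (Sigma : finType) (Gamma : {set 'I_D * 'I_D}) (r : nat)
    (phi : eFO Sigma Gamma r) : seq nat :=
  match phi with
  | eLoc x _ _ => [:: x]
  | eEq x y => [:: x; y]
  | eNeq x y => [:: x; y]
  | eEx x p => [seq y <- efv p | y != x]
  | eOr p q => efv p ++ efv q
  | eAnd p q => efv p ++ efv q
  end.

(* For D > 0, the only u with val u = I x is I x seen as a point of its own   *)
(* view.  insubd restricts I to the view, sending the variables whose value   *)
(* lies outside to u; these are not free in psi.                              *)
Fixpoint esat (D : nat) (Sigma : finType) (Gamma : {set 'I_D * 'I_D}) (r : nat)
    (A : finType) (str : data D Sigma A) (I : nat -> A)
    (phi : eFO Sigma Gamma r) : bool :=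
  match phi with
  | eLoc x psi _ =>
      [exists u : {b : A | b \in view_dom Gamma str r (I x)},
        (val u == I x)
        && dsat (view Gamma str r (I x)) (fun y => insubd u (I y)) psi]
  | eEq x y => I x == I y
  | eNeq x y => I x != I y
  | eEx x p => [exists a, esat str [eta I with x |-> a] p]
  | eOr p q => esat str I p || esat str I q
  | eAnd p q => esat str I p && esat str I q
  end.

(* An input of the problem; the finite signature is presented as 'I_nsym. *)
Record instance (D : nat) (Gamma : {set 'I_D * 'I_D}) (r : nat) := Instance {
  nsym : nat;
  sentence : eFO 'I_nsym Gamma r;
  sentence_closed : efv sentence == [::] }.

Definition DataSat (D : nat) (Gamma : {set 'I_D * 'I_D}) (r : nat)
    (inst : instance Gamma r) : Prop :=
  exists (A : finType) (str : data D 'I_(nsym inst) A),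
    0 < #|A| /\ forall I : nat -> A, esat str I (sentence inst).

(* Goedel numbering of the inputs. *)
Definition cpair (m n : nat) : nat := Cantor.to_nat (m, n).

Fixpoint dcode (D n : nat) (Gamma : {set 'I_D * 'I_D})
    (psi : dFO 'I_n Gamma) : nat :=
  match psi with
  | dPred s x => cpair 0 (cpair s x)
  | dSim i j _ x y => cpair 1 (cpair (cpair i j) (cpair x y))
  | dEq x y => cpair 2 (cpair x y)
  | dOr p q => cpair 3 (cpair (dcode p) (dcode q))
  | dNot p => cpair 4 (dcode p)
  | dEx x p => cpair 5 (cpair x (dcode p))
  end.

Fixpoint ecode (D n : nat) (Gamma : {set 'I_D * 'I_D}) (r : nat)
    (phi : eFO 'I_n Gamma r) : nat :=
  match phi with
  | eLoc x psi _ => cpair 0 (cpair x (dcode psi))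
  | eEq x y => cpair 1 (cpair x y)
  | eNeq x y => cpair 2 (cpair x y)
  | eEx x p => cpair 3 (cpair x (ecode p))
  | eOr p q => cpair 4 (cpair (ecode p) (ecode q))
  | eAnd p q => cpair 5 (cpair (ecode p) (ecode q))
  end.

Definition icode (D : nat) (Gamma : {set 'I_D * 'I_D}) (r : nat)
    (inst : instance Gamma r) : nat :=
  cpair (nsym inst) (ecode (sentence inst)).

Lemma cpair_inj m n p q : cpair m n = cpair p q -> m = p /\ n = q.
Proof. by move/Cantor.to_nat_inj => [-> ->]. Qed.

Lemma dcode_inj D n (Gamma : {set 'I_D * 'I_D}) :
  injective (@dcode D n Gamma).
Proof.
elim=> [s x|i j h x y|x y|p IHp q IHq|p IHp|x p IHp]
  [s' x'|i' j' h' x' y'|x' y'|p' q'|p'|x' p'] //= /cpair_inj[] // _.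
- by move=> /cpair_inj[/val_inj-> ->].
- move=> /cpair_inj[/cpair_inj[/val_inj ei /val_inj ej] /cpair_inj[-> ->]].
  by case: _ / ei in h' *; case: _ / ej in h' *; rewrite (bool_irrelevance h h').
- by move=> /cpair_inj[-> ->].
- by move=> /cpair_inj[/IHp-> /IHq->].
- by move=> /IHp->.
- by move=> /cpair_inj[-> /IHp->].
Qed.

Lemma ecode_inj D n (Gamma : {set 'I_D * 'I_D}) r :
  injective (@ecode D n Gamma r).
Proof.
elim=> [x p h|x y|x y|x p IHp|p IHp q IHq|p IHp q IHq]
  [x' p' h'|x' y'|x' y'|x' p'|p' q'|p' q'] //= /cpair_inj[] // _ /cpair_inj[].
- move=> ex /dcode_inj ep; case: _ / ex in h' *; case: _ / ep in h' *.
  by rewrite (bool_irrelevance h h').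
- by move=> -> ->.
- by move=> -> ->.
- by move=> -> /IHp->.
- by move=> /IHp-> /IHq->.
- by move=> /IHp-> /IHq->.
Qed.

Lemma icode_inj D (Gamma : {set 'I_D * 'I_D}) r : injective (@icode D Gamma r).
Proof.
move=> [n p h] [n' p' h'] /cpair_inj[/= en].
case: _ / en in p' h' * => /ecode_inj ep.
by case: _ / ep in h' *; rewrite (bool_irrelevance h h').
Qed.

(* Partial recursive functions of arity n. *)
Inductive recf : nat -> Type :=
| rZero n : recf n
| rSucc : recf 1
| rProj n (i : 'I_n) : recf n
| rComp m n (g : recf m) (h : 'I_m -> recf n) : recf n
| rPrim n (g : recf n) (h : recf n.+2) : recf n.+1
| rMin n (g : recf n.+1) : recf n.

(* computes f v y: f is defined at v, with value y. *)
Fixpoint computes (n : nat) (f : recf n) : n.-tuple nat -> nat -> Prop :=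
  match f in recf n return n.-tuple nat -> nat -> Prop with
  | rZero n => fun _ y => y = 0
  | rSucc => fun v y => y = (thead v).+1
  | rProj n i => fun v y => y = tnth v i
  | rComp m n g h => fun v y => exists w : m.-tuple nat,
      (forall i, computes (h i) v (tnth w i)) /\ computes g w y
  | rPrim n g h => fun v =>
      (fix iter_h (k : nat) : nat -> Prop :=
         match k with
         | 0 => computes g [tuple of behead v]
         | k'.+1 => fun y => exists z,
             iter_h k' z /\ computes h [tuple of k' :: z :: behead v] y
         end) (thead v)
  | rMin n g => fun v y => computes g [tuple of y :: v] 0 /\
      forall z, z < y -> exists t, computes g [tuple of z :: v] t.+1
  end.

Definition undecidable (X : Type) (code : X -> nat) (P : X -> Prop) : Prop :=
  ~ exists f : recf 1, forall x : X,
      (P x -> computes f [tuple code x] 1) /\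
      (~ P x -> computes f [tuple code x] 0).

(* Main.v *)
(* With f_1 and f_2 the two projections of V * V, any element of the grid V * V
   reaches every vertex of the data graph in three steps, so a single local
   formula of radius 3 speaks about the whole structure; and a unary predicate
   on V * V is an arbitrary binary relation on V.  Hence, for a partial recursive
   F, "F maps k to 0" becomes a satisfiability question: the sentence describes a
   linear order (the numbers), the numeral k, and a finite table of facts "the
   subterm g of F maps v to y", each of which is justified by other facts.

   A decision procedure f is refuted by diagonalization: with s(n) the code of
   the instance "the template coded by n, at input n", F := f o s and n the code
   of the template of F, the instance coded by s(n) is satisfiable iff f rejects
   it.  Only the substitution s has to be programmed as a recursive function. *)

Require Import Defs.
From mathcomp Require Import all_boot.
From Stdlib Require Cantor.

Set Implicit Arguments.
Unset Strict Implicit.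
Unset Printing Implicit Defensive.

(** * Partial recursive functions *)

(** Replaces the anonymous fixpoint inside [computes] by [nat_rect], with the recursion argument and
    the parameters separated. *)
Lemma computes_primE n (g : recf n) h k (v : n.-tuple nat) y :
  computes (rPrim g h) [tuple of k :: v] y <->
  nat_rect (fun=> nat -> Prop) (computes g v)
    (fun i R t => exists z, R z /\ computes h [tuple of i :: z :: v] t) k y.
Proof.
rewrite /computes -/computes theadE.
have -> : [tuple of behead (k :: v)] = v by apply: val_inj.
have e i z : [tuple of i :: z :: behead [tuple of k :: v]] = [tuple of i :: z :: v].
  exact: val_inj.
(* The tuple is generalized because it mentions [k]; otherwise the induction would change it along
   with the counter. *)
move: [tuple of k :: v] e => u e; elim: k y => [|i IHi] y /=; first by [].
by split=> -[z [hz hy]]; exists z; rewrite ?e in hy *; split=> //; apply/IHi.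
Qed.

Lemma computes_prim0 n (g : recf n) h (v : n.-tuple nat) y :
  computes (rPrim g h) [tuple of 0 :: v] y <-> computes g v y.
Proof. exact: computes_primE. Qed.

Lemma computes_primS n (g : recf n) h k (v : n.-tuple nat) y :
  computes (rPrim g h) [tuple of k.+1 :: v] y <->
  exists z, computes (rPrim g h) [tuple of k :: v] z /\
            computes h [tuple of k :: z :: v] y.
Proof.
rewrite computes_primE /=.
by split=> -[z [hz hy]]; exists z; split=> //; apply/computes_primE.
Qed.

(** For minimization, if two results differed, [g] would take both the value 0 and a positive value
    at the smaller one. *)
Lemma computes_functional n (f : recf n) v y y' :
  computes f v y -> computes f v y' -> y = y'.
Proof.
elim: f v y y' => {n} [n||n i|m n g IHg h IHh|n g IHg h IHh|n g IHg] v y y'.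
- by move=> -> ->.
- by move=> -> ->.
- by move=> -> ->.
- move=> [w [hw gw]] [w' [hw' gw']]; have ww : w = w'.
    by apply: eq_from_tnth => i; apply: IHh (hw i) (hw' i).
  by rewrite -ww in gw'; apply: IHg gw gw'.
- case/tupleP: v => k v; elim: k y y' => [|k IHk] y y'.
    by move=> /computes_prim0 + /computes_prim0; apply: IHg.
  move=> /computes_primS[z [hz hy]] /computes_primS[z' [hz' hy']].
  by rewrite (IHk _ _ hz' hz) in hy'; apply: IHh hy hy'.
- move=> [gy ly] [gy' ly']; case: (ltngtP y y') => // lt.
  + by have [t /(IHg _ _ _ gy)] := ly' _ lt.
  + by have [t /(IHg _ _ _ gy')] := ly _ lt.
Qed.

Definition represents n (r : recf n) (F : n.-tuple nat -> nat) :=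
  forall v y, computes r v y <-> y = F v.

Lemma represents_ext n (r : recf n) F G :
  represents r F -> F =1 G -> represents r G.
Proof. by move=> h e v y; rewrite -e. Qed.

Lemma represents_proj n (i : 'I_n) : represents (rProj i) (fun v => tnth v i).
Proof. by []. Qed.

Lemma represents_succ : represents rSucc (fun v => (thead v).+1).
Proof. by []. Qed.

Definition rComp1 n (g : recf 1) (a : recf n) := rComp g (fun _ : 'I_1 => a).
Definition rComp2 n (g : recf 2) (a b : recf n) :=
  rComp g (fun i : 'I_2 => if i == ord0 then a else b).

(** Only the inner function is total here: the lemma is also applied to a decision procedure [f],
    which may be partial. *)
Lemma computes_comp1 n (f : recf 1) (s : recf n) v c y :
  (forall z, computes s v z <-> z = c) ->
  computes (rComp1 f s) v y <-> computes f [tuple c] y.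
Proof.
move=> hs; split=> [[w [hw fw]]|fc].
  have <- : w = [tuple c] by apply: eq_from_tnth => i; rewrite ord1; apply/hs/hw.
  exact: fw.
by exists [tuple c]; split=> // i; rewrite ord1; apply/hs.
Qed.

Lemma represents_comp1 n g (a : recf n) G F :
  represents g G -> represents a F ->
  represents (rComp1 g a) (fun v => G [tuple F v]).
Proof. by move=> hg ha v y; rewrite (computes_comp1 _ _ (ha v)); apply: hg. Qed.

Lemma represents_comp2 n g (a b : recf n) G F F' :
  represents g G -> represents a F -> represents b F' ->
  represents (rComp2 g a b) (fun v => G [tuple F v; F' v]).
Proof.
move=> hg ha hb v y; split=> [[w [hw /hg->]]|->].
  congr G; apply: eq_from_tnth => -[[|[|//]] hi].
  - by apply/ha; apply: (hw (Ordinal hi)).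
  - by apply/hb; apply: (hw (Ordinal hi)).
exists [tuple F v; F' v]; split; last exact/hg.
move=> [[|[|//]] hi] /=; [exact/ha|exact/hb].
Qed.

Lemma represents_prim n (g : recf n) h G H :
  represents g G -> represents h H ->
  forall k (v : n.-tuple nat) y, computes (rPrim g h) [tuple of k :: v] y <->
    y = nat_rect _ (G v) (fun i z => H [tuple of i :: z :: v]) k.
Proof.
move=> hg hh k v; elim: k => [|k IHk] y.
  by rewrite computes_prim0; apply: hg.
rewrite computes_primS /=; split=> [[z [/IHk-> /hh//]]|->].
by eexists; split; [exact/IHk|exact/hh].
Qed.

Definition rConst n c : recf n := iter c (rComp1 rSucc) (rZero n).

Lemma represents_const n c : represents (rConst n c) (fun=> c).
Proof.
elim: c => [|c IHc] //=; exact: represents_comp1 represents_succ IHc.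
Qed.

Definition rAdd : recf 2 :=
  rPrim (rProj (ord0 : 'I_1)) (rComp1 rSucc (rProj (lift ord0 ord0 : 'I_3))).

Lemma represents_add : represents rAdd (fun v => tnth v ord0 + tnth v ord_max).
Proof.
case/tupleP=> a; case/tupleP=> b v y; rewrite (tuple0 v) {v}.
rewrite (represents_prim (represents_proj ord0)
  (represents_comp1 represents_succ (represents_proj (lift ord0 ord0)))).
rewrite (_ : nat_rect _ _ _ _ = a + b) //.
by elim: a => //= a ->.
Qed.

(** Triangular numbers: [cpair m n] is [n] plus the triangular number of [n + m]. *)
Definition rTri : recf 1 :=
  rPrim (rZero 0) (rComp2 rAdd (rComp1 rSucc (rProj ord0)) (rProj ord_max)).

Definition rPair : recf 2 :=
  rComp2 rAdd (rProj ord_max)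
    (rComp1 rTri (rComp2 rAdd (rProj ord_max) (rProj ord0))).

Lemma represents_pair :
  represents rPair (fun v => cpair (tnth v ord0) (tnth v ord_max)).
Proof.
(* [T] copies the recursion inside [Cantor.to_nat], so that the last equation holds by
   conversion. *)
pose T n := nat_rec (fun=> nat) 0 (fun i m => i.+1 + m) n.
have repT : represents rTri (fun v => T (thead v)).
  case/tupleP=> k v y; rewrite (tuple0 v) {v} theadE /rTri [rZero 0]/(rConst 0 0).
  rewrite (represents_prim (represents_const (n := 0) 0) (represents_comp2 represents_add
    (represents_comp1 represents_succ (represents_proj ord0))
    (represents_proj ord_max))).
  rewrite (_ : nat_rect _ _ _ _ = T k) //.
apply: (represents_ext (represents_comp2 represents_add (represents_proj ord_max)
  (represents_comp1 repT (represents_comp2 represents_add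
    (represents_proj ord_max) (represents_proj ord0))))).
by move=> v; rewrite /cpair /Cantor.to_nat.
Qed.

Lemma represents_cpair n (a b : recf n) F F' :
  represents a F -> represents b F' ->
  represents (rComp2 rPair a b) (fun v => cpair (F v) (F' v)).
Proof.
by move=> ha hb; apply: represents_ext (represents_comp2 represents_pair ha hb) _.
Qed.

(** * Formulas *)

(* Over an unbounded supply of predicate symbols, so that the code of a formula
   is known before the size of the signature is fixed. *)
Inductive form : Type :=
| fPred of nat & nat
| fSim of bool & nat & nat
| fEq of nat & nat
| fOr of form & form
| fNot of form
| fEx of nat & form.

(** Common abstraction of views and grids; [msim false] and [msim true] stand for agreement in the
    first and in the second data value. *)
Record model (A : Type) := Model { mpred : nat -> A -> bool; msim : bool -> rel A }.

Fixpoint fsat (A : finType) (M : model A) (I : nat -> A) (p : form) : bool :=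
  match p with
  | fPred s x => mpred M s (I x)
  | fSim b x y => msim M b (I x) (I y)
  | fEq x y => I x == I y
  | fOr p q => fsat M I p || fsat M I q
  | fNot p => ~~ fsat M I p
  | fEx x p => [exists a, fsat M [eta I with x |-> a] p]
  end.

Fixpoint fvin (s : seq nat) (p : form) : bool :=
  match p with
  | fPred _ x => x \in s
  | fSim _ x y => (x \in s) && (y \in s)
  | fEq x y => (x \in s) && (y \in s)
  | fOr p q => fvin s p && fvin s q
  | fNot p => fvin s p
  | fEx x p => fvin (x :: s) p
  end.

(** Designed to agree with [dcode] after translation: a boolean counts as 0 or 1, the index given by
    [ord_of_bool]. *)
Fixpoint fcode (p : form) : nat :=
  match p with
  | fPred s x => cpair 0 (cpair s x)
  | fSim b x y => cpair 1 (cpair (cpair b b) (cpair x y))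
  | fEq x y => cpair 2 (cpair x y)
  | fOr p q => cpair 3 (cpair (fcode p) (fcode q))
  | fNot p => cpair 4 (fcode p)
  | fEx x p => cpair 5 (cpair x (fcode p))
  end.

(** Pairing dominates its components, so every predicate symbol of a formula is bounded by the code
    of the formula. *)
Lemma leq_cpair m n : m + n <= cpair m n.
Proof.
rewrite addnC /cpair; apply/leP; exact: Cantor.to_nat_non_decreasing.
Qed.

Lemma leq_cpairl m n : m <= cpair m n.
Proof. exact: leq_trans (leq_addr _ _) (leq_cpair m n). Qed.

Lemma leq_cpairr m n : n <= cpair m n.
Proof. exact: leq_trans (leq_addl _ _) (leq_cpair m n). Qed.

Definition diag_rel : {set 'I_2 * 'I_2} := [set (ord0, ord0); (ord_max, ord_max)].

Definition ord_of_bool (b : bool) : 'I_2 := if b then ord_max else ord0.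

Lemma diag_relP b : (ord_of_bool b, ord_of_bool b) \in diag_rel.
Proof. by case: b; rewrite in_set2 eqxx ?orbT. Qed.

(** [inord] sends symbols above [K] to 0; codes are preserved once [fcode p <= K]. *)
Fixpoint to_dFO (K : nat) (p : form) : dFO 'I_K.+1 diag_rel :=
  match p with
  | fPred s x => dPred _ (inord s) x
  | fSim b x y => dSim _ (diag_relP b) x y
  | fEq x y => dEq _ _ x y
  | fOr p q => dOr (to_dFO K p) (to_dFO K q)
  | fNot p => dNot (to_dFO K p)
  | fEx x p => dEx x (to_dFO K p)
  end.

Lemma dcode_to_dFO K p : fcode p <= K -> dcode (to_dFO K p) = fcode p.
Proof.
elim: p => [s x|b x y|x y|p IHp q IHq|p IHp|x p IHp] //= h.
- rewrite inordK // ltnS; apply: leq_trans h.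
  exact: leq_trans (leq_cpairl s x) (leq_cpairr _ _).
- by case: b h.
- by rewrite IHp ?IHq //; apply: leq_trans h; apply: leq_trans (leq_cpairr _ _);
    [exact: leq_cpairr|exact: leq_cpairl].
- by rewrite IHp //; apply: leq_trans h; apply: leq_cpairr.
- by rewrite IHp //; apply: leq_trans h; apply: leq_trans (leq_cpairr _ _);
    apply: leq_cpairr.
Qed.

Lemma dfv_to_dFO K s p : fvin s p -> all (mem s) (dfv (to_dFO K p)).
Proof.
elim: p s => [t x|b x y|x y|p IHp q IHq|p IHp|x p IHp] s //=; rewrite ?andbT //.
- by move=> /andP[hp hq]; rewrite all_cat IHp ?IHq.
- exact: IHp.
- move=> /IHp /allP h; apply/allP => y; rewrite mem_filter => /andP[yx /h].
  by rewrite /= in_cons (negbTE yx).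
Qed.

Definition model_of (K : nat) (A : finType) (str : data 2 'I_K.+1 A) : model A :=
  Model (fun s a => a \in dpred str (inord s))
        (fun b a c => dval str (ord_of_bool b) a == dval str (ord_of_bool b) c).

Lemma dsat_to_dFO K (A : finType) (str : data 2 'I_K.+1 A) I p :
  dsat str I (to_dFO K p) = fsat (model_of str) I p.
Proof.
elim: p I => [s x|b x y|x y|p IHp q IHq|p IHp|x p IHp] I //=.
- by rewrite IHp IHq.
- by rewrite IHp.
- by apply: eq_existsb => a.
Qed.

(** The isomorphism has to respect only the symbols up to [K], since the bound on the code excludes
    all others from [p]. *)
Lemma fsat_iso (A A' : finType) (M : model A) (M' : model A') (h : A -> A') K :
  bijective h ->
  (forall s a, s <= K -> mpred M' s (h a) = mpred M s a) ->
  (forall b a c, msim M' b (h a) (h c) = msim M b a c) ->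
  forall p I I', fcode p <= K -> (forall x, h (I x) = I' x) ->
  fsat M I p = fsat M' I' p.
Proof.
move=> hb hp hs; elim=> [s x|b x y|x y|p IHp q IHq|p IHp|x p IHp] I I' hK hI /=.
- rewrite -hI hp //; apply: leq_trans hK.
  exact: leq_trans (leq_cpairl s x) (leq_cpairr _ _).
- by rewrite -!hI hs.
- by rewrite -!hI (inj_eq (bij_inj hb)).
- by congr (_ || _); [apply: IHp|apply: IHq] => //; apply: leq_trans hK;
    apply: leq_trans (leq_cpairr _ _); [exact: leq_cpairl|exact: leq_cpairr].
- by rewrite (IHp _ I') //; apply: leq_trans hK; apply: leq_cpairr.
- have hK' : fcode p <= K.
    by apply: leq_trans hK; apply: leq_trans (leq_cpairr _ _); apply: leq_cpairr.
  have [g hg gh] := hb.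
  apply/existsP/existsP => -[a ha].
    exists (h a); rewrite -(IHp [eta I with x |-> a]) // => y /=.
    by case: ifP.
  exists (g a); rewrite (IHp _ [eta I' with x |-> a]) // => y /=.
  by case: ifP; rewrite ?gh.
Qed.

Definition fAnd p q := fNot (fOr (fNot p) (fNot q)).
Definition fImp p q := fOr (fNot p) q.
Definition fAll x p := fNot (fEx x (fNot p)).
Definition fTrue := fAll 0 (fEq 0 0).

Section Derived.
Variables (A : finType) (M : model A).
Implicit Types (I : nat -> A) (p q : form).

Lemma fsat_and I p q : fsat M I (fAnd p q) = fsat M I p && fsat M I q.
Proof. by rewrite /= negb_or !negbK. Qed.

Lemma fsat_imp I p q : fsat M I (fImp p q) = (fsat M I p ==> fsat M I q).
Proof. by rewrite /= implybE. Qed.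

Lemma fsat_not I p : fsat M I (fNot p) = ~~ fsat M I p.
Proof. by []. Qed.

Lemma fsat_or I p q : fsat M I (fOr p q) = fsat M I p || fsat M I q.
Proof. by []. Qed.

Lemma fsat_ex I x p :
  fsat M I (fEx x p) = [exists a, fsat M [eta I with x |-> a] p].
Proof. by []. Qed.

Lemma fsat_all I x p :
  fsat M I (fAll x p) = [forall a, fsat M [eta I with x |-> a] p].
Proof. by rewrite /= negb_exists; apply: eq_forallb => a; rewrite negbK. Qed.

Lemma fsat_true I : fsat M I fTrue.
Proof. by rewrite fsat_all; apply/forallP => a /=. Qed.

Lemma fsat_bigand I m (F : 'I_m -> form) :
  fsat M I (\big[fAnd/fTrue]_i F i) = [forall i, fsat M I (F i)].
Proof.
rewrite (big_morph (fsat M I) (fsat_and I) (fsat_true I)).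
by rewrite big_andE.
Qed.

End Derived.

Lemma fvin_and s p q : fvin s (fAnd p q) = fvin s p && fvin s q.
Proof. by []. Qed.

Lemma fvin_bigand s m (F : 'I_m -> form) :
  fvin s (\big[fAnd/fTrue]_i F i) = [forall i, fvin s (F i)].
Proof.
by rewrite (big_morph (fvin s) (fvin_and s) (erefl : fvin s fTrue = true)) big_andE.
Qed.

(* Entry 0 of a fact is the value, the others are the arguments; [c] is the
   position of the subterm which the fact is about. *)
Definition num_sym := 0.
Definition lt_sym := 1.
Definition arg_sym j := j.*2.+2.
Definition tab_sym (c : seq nat) := (pickle c).*2.+3.

Definition fNum x := fPred num_sym x.
(** A binary relation coded by a unary predicate: the pair of [x] and [y] is a point with the first
    value of [x] and the second value of [y]. The variable [(x + y).+1] differs from both. *)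
Definition fLink s x y :=
  let z := (x + y).+1 in
  fEx z (fAnd (fPred s z) (fAnd (fSim false z x) (fSim true z y))).
Definition fArg j x y := fAnd (fNum y) (fLink (arg_sym j) x y).
Definition fZero x := fAll x.+1 (fImp (fNum x.+1) (fNot (fLink lt_sym x.+1 x))).
Definition fSucc x y :=
  let z := (x + y).+1 in
  fAnd (fLink lt_sym x y) (fAll z (fImp (fNum z) (fImp (fLink lt_sym z y)
    (fOr (fLink lt_sym z x) (fEq z x))))).
(** In an arbitrary model an entry may carry several numbers or none. Inclusion hands every number
    read at one entry on to another; [fShare] instead produces a number, linking a result to its
    use. *)
Definition fIncl i x j y :=
  let z := (x + y).+1 in fAll z (fImp (fArg i x z) (fArg j y z)).
Definition fShare i x j y :=
  let z := (x + y).+1 in fEx z (fAnd (fArg i x z) (fArg j y z)).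

(** * Relations between points of a model *)

Section Arrows.
Variables (A : finType) (M : model A).
Implicit Types (I : nat -> A).

Definition num x := mpred M num_sym x.
Definition link s x y := [exists z, [&& mpred M s z, msim M false z x & msim M true z y]].
Definition nlt := link lt_sym.
Definition arg j x y := num y && link (arg_sym j) x y.
Definition zero x := [forall z, num z ==> ~~ nlt z x].
Definition succ x y := nlt x y && [forall z, num z ==> nlt z y ==> nlt z x || (z == x)].
Definition incl i x j y := [forall z, arg i x z ==> arg j y z].
Definition share i x j y := [exists z, arg i x z && arg j y z].

Lemma neq_addSl x y : (x == (x + y).+1) = false.
Proof. by apply/negbTE; rewrite neq_ltn ltnS leq_addr. Qed.

Lemma neq_addSr x y : (y == (x + y).+1) = false.
Proof. by rewrite addnC neq_addSl. Qed.

Lemma fsat_link I s x y : fsat M I (fLink s x y) = link s (I x) (I y).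
Proof.
rewrite fsat_ex; apply: eq_existsb => a.
by rewrite !fsat_and /= eqxx neq_addSl neq_addSr.
Qed.

Lemma fsat_arg I j x y : fsat M I (fArg j x y) = arg j (I x) (I y).
Proof. by rewrite fsat_and fsat_link. Qed.

Lemma fsat_zero I x : fsat M I (fZero x) = zero (I x).
Proof.
rewrite fsat_all; apply: eq_forallb => a.
rewrite fsat_imp fsat_not fsat_link /= eqxx.
by rewrite eqn_leq ltnn andbF.
Qed.

Lemma fsat_succ I x y : fsat M I (fSucc x y) = succ (I x) (I y).
Proof.
rewrite fsat_and fsat_link fsat_all; congr (_ && _); apply: eq_forallb => a.
by rewrite !fsat_imp fsat_or !fsat_link /= eqxx neq_addSl neq_addSr.
Qed.

Lemma fsat_incl I i x j y : fsat M I (fIncl i x j y) = incl i (I x) j (I y).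
Proof.
rewrite fsat_all; apply: eq_forallb => a.
by rewrite fsat_imp !fsat_arg /= eqxx neq_addSl neq_addSr.
Qed.

Lemma fsat_share I i x j y : fsat M I (fShare i x j y) = share i (I x) j (I y).
Proof.
rewrite fsat_ex; apply: eq_existsb => a.
by rewrite fsat_and !fsat_arg /= eqxx neq_addSl neq_addSr.
Qed.
End Arrows.

(** * Tables of facts *)

Definition fTab c x := fPred (tab_sym c) x.

Definition fOrder :=
  fAll 0 (fImp (fNum 0) (fAnd (fNot (fLink lt_sym 0 0))
    (fAll 1 (fImp (fNum 1) (fAnd
      (fImp (fNot (fEq 0 1)) (fOr (fLink lt_sym 0 1) (fLink lt_sym 1 0)))
      (fAll 2 (fImp (fNum 2) (fImp (fLink lt_sym 0 1)
        (fImp (fLink lt_sym 1 2) (fLink lt_sym 0 2)))))))))).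

Definition fZeroStep c :=
  fAll 0 (fImp (fTab c 0) (fAll 1 (fImp (fArg 0 0 1) (fZero 1)))).

Definition fSuccStep c :=
  fAll 0 (fImp (fTab c 0) (fAll 1 (fImp (fArg 1 0 1)
    (fAll 2 (fImp (fArg 0 0 2) (fSucc 1 2)))))).

Definition fProjStep i c :=
  fAll 0 (fImp (fTab c 0) (fAll 1 (fImp (fArg i.+1 0 1)
    (fAll 2 (fImp (fArg 0 0 2) (fEq 1 2)))))).

(** Child 0 is the outer function and child [i.+1] the inner function [i]. All inner facts feed one
    outer fact, at variable 1. *)
Definition fCompStep m n c :=
  fAll 0 (fImp (fTab c 0) (fEx 1 (fAnd (fTab (rcons c 0) 1) (fAnd (fIncl 0 0 0 1)
    (\big[fAnd/fTrue]_(i < m) fEx 2 (fAnd (fTab (rcons c i.+1) 2)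
      (fAnd (\big[fAnd/fTrue]_(j < n) fIncl j.+1 0 j.+1 2)
            (fShare 0 2 i.+1 1)))))))).

(** Entry 1 is the recursion argument, and the parameters start at entry 2. In a fact about the step
    function entry 2 is the previous value, which shifts the parameters to entry 3. *)
Definition fPrimStep n c :=
  fAll 0 (fImp (fTab c 0) (fOr
    (fAnd (fAll 1 (fImp (fArg 1 0 1) (fZero 1)))
      (fEx 1 (fAnd (fTab (rcons c 0) 1) (fAnd (fIncl 0 0 0 1)
        (\big[fAnd/fTrue]_(j < n) fIncl j.+2 0 j.+1 1)))))
    (fEx 1 (fAnd (fTab c 1) (fEx 2 (fAnd (fTab (rcons c 1) 2) (fAnd
      (fEx 3 (fAnd (fArg 1 1 3) (fAnd (fArg 1 2 3)
        (fAll 4 (fImp (fArg 1 0 4) (fSucc 3 4))))))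
      (fAnd (fShare 0 1 2 2) (fAnd (fIncl 0 0 0 2)
        (\big[fAnd/fTrue]_(j < n)
          fAnd (fIncl j.+2 0 j.+2 1) (fIncl j.+2 0 j.+3 2))))))))))).

(** The candidate is argument 1 of the child: the result must give value zero there, and each
    smaller number a nonzero value. *)
Definition fMinStep n c :=
  fAll 0 (fImp (fTab c 0) (fAnd
    (fEx 1 (fAnd (fTab (rcons c 0) 1) (fAnd (fIncl 0 0 1 1)
      (fAnd (\big[fAnd/fTrue]_(j < n) fIncl j.+1 0 j.+2 1)
        (fEx 2 (fAnd (fArg 0 1 2) (fZero 2)))))))
    (fAll 1 (fImp (fArg 0 0 1) (fAll 2 (fImp (fNum 2) (fImp (fLink lt_sym 2 1)
      (fEx 3 (fAnd (fTab (rcons c 0) 3) (fAnd (fArg 1 3 2)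
        (fAnd (\big[fAnd/fTrue]_(j < n) fIncl j.+1 0 j.+2 3)
          (fEx 4 (fAnd (fArg 0 3 4) (fNot (fZero 4))))))))))))))).

(* Facts about position [c] are justified by facts about the children of [c], or
   about [c] itself with a smaller recursion argument. *)
Fixpoint fTables n (f : recf n) (c : seq nat) : form :=
  match f with
  | rZero _ => fZeroStep c
  | rSucc => fSuccStep c
  | rProj _ i => fProjStep i c
  | rComp m n g h => fAnd (fCompStep m n c) (fAnd (fTables g (rcons c 0))
      (\big[fAnd/fTrue]_(i < m) fTables (h i) (rcons c i.+1)))
  | rPrim n g h => fAnd (fPrimStep n c)
      (fAnd (fTables g (rcons c 0)) (fTables h (rcons c 1)))
  | rMin n g => fAnd (fMinStep n c) (fTables g (rcons c 0))
  end.

(** * Meaning of the step formulas *)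

Section StepSemantics.
Variables (A : finType) (M : model A).
Implicit Types (I : nat -> A) (c : seq nat).
Local Notation num := (num M).
Local Notation nlt := (nlt M).
Local Notation arg := (arg M).
Local Notation zero := (zero M).
Local Notation succ := (succ M).
Local Notation incl := (incl M).
Local Notation share := (share M).

Definition tabled c x := mpred M (tab_sym c) x.

(** The [den_] lemmas are rules by which [denote] follows the syntax of a formula and proves its
    reading as a proposition; valuations at concrete variables evaluate away. *)
Lemma den_and I p q (P Q : Prop) : reflect P (fsat M I p) ->
  reflect Q (fsat M I q) -> reflect (P /\ Q) (fsat M I (fAnd p q)).
Proof. by rewrite fsat_and; apply: andPP. Qed.

Lemma den_or I p q (P Q : Prop) : reflect P (fsat M I p) ->
  reflect Q (fsat M I q) -> reflect (P \/ Q) (fsat M I (fOr p q)).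
Proof. exact: orPP. Qed.

Lemma den_imp I p q (P Q : Prop) : reflect P (fsat M I p) ->
  reflect Q (fsat M I q) -> reflect (P -> Q) (fsat M I (fImp p q)).
Proof. by rewrite fsat_imp; apply: implyPP. Qed.

Lemma den_not I p (P : Prop) : reflect P (fsat M I p) ->
  reflect (~ P) (fsat M I (fNot p)).
Proof. exact: negPP. Qed.

Lemma den_all I x p (P : A -> Prop) :
  (forall a, reflect (P a) (fsat M [eta I with x |-> a] p)) ->
  reflect (forall a, P a) (fsat M I (fAll x p)).
Proof. by rewrite fsat_all; apply: forallPP. Qed.

Lemma den_ex I x p (P : A -> Prop) :
  (forall a, reflect (P a) (fsat M [eta I with x |-> a] p)) ->
  reflect (exists a, P a) (fsat M I (fEx x p)).
Proof. exact: existsPP. Qed.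

Lemma den_bigand I m (F : 'I_m -> form) (P : 'I_m -> Prop) :
  (forall i, reflect (P i) (fsat M I (F i))) ->
  reflect (forall i, P i) (fsat M I (\big[fAnd/fTrue]_i F i)).
Proof. by rewrite fsat_bigand; apply: forallPP. Qed.

Lemma den_lt I x y : reflect (nlt (I x) (I y)) (fsat M I (fLink lt_sym x y)).
Proof. by rewrite fsat_link; apply: idP. Qed.

Lemma den_arg I j x y : reflect (arg j (I x) (I y)) (fsat M I (fArg j x y)).
Proof. by rewrite fsat_arg; apply: idP. Qed.

Lemma den_zero I x : reflect (zero (I x)) (fsat M I (fZero x)).
Proof. by rewrite fsat_zero; apply: idP. Qed.

Lemma den_succ I x y : reflect (succ (I x) (I y)) (fsat M I (fSucc x y)).
Proof. by rewrite fsat_succ; apply: idP. Qed.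

Lemma den_incl I i x j y :
  reflect (incl i (I x) j (I y)) (fsat M I (fIncl i x j y)).
Proof. by rewrite fsat_incl; apply: idP. Qed.

Lemma den_share I i x j y :
  reflect (share i (I x) j (I y)) (fsat M I (fShare i x j y)).
Proof. by rewrite fsat_share; apply: idP. Qed.

Ltac denote := repeat first
  [ exact: den_lt
  | exact: den_arg | exact: den_zero | exact: den_succ | exact: den_incl
  | exact: den_share | apply: den_all => ? | apply: den_ex => ?
  | apply: den_bigand => ? | apply: den_and | apply: den_imp | apply: den_or
  | apply: den_not | exact: idP | exact: eqP ].

Lemma fOrderP I : reflect
  (forall x, num x -> ~ nlt x x /\
     forall y, num y -> (~ (x = y) -> nlt x y \/ nlt y x) /\
       forall z, num z -> nlt x y -> nlt y z -> nlt x z)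
  (fsat M I fOrder).
Proof. denote. Qed.

Lemma fZeroStepP I c : reflect
  (forall p, tabled c p -> forall y, arg 0 p y -> zero y)
  (fsat M I (fZeroStep c)).
Proof. denote. Qed.

Lemma fSuccStepP I c : reflect
  (forall p, tabled c p -> forall x, arg 1 p x -> forall y, arg 0 p y -> succ x y)
  (fsat M I (fSuccStep c)).
Proof. denote. Qed.

Lemma fProjStepP I i c : reflect
  (forall p, tabled c p -> forall x, arg i.+1 p x -> forall y, arg 0 p y -> x = y)
  (fsat M I (fProjStep i c)).
Proof. denote. Qed.

Lemma fCompStepP I m n c : reflect
  (forall p, tabled c p -> exists r, tabled (rcons c 0) r /\ incl 0 p 0 r /\
     forall i : 'I_m, exists q, tabled (rcons c i.+1) q /\
       (forall j : 'I_n, incl j.+1 p j.+1 q) /\ share 0 q i.+1 r)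
  (fsat M I (fCompStep m n c)).
Proof. denote. Qed.

Lemma fPrimStepP I n c : reflect
  (forall p, tabled c p ->
     (forall x, arg 1 p x -> zero x) /\
       (exists q, tabled (rcons c 0) q /\ incl 0 p 0 q /\
          forall j : 'I_n, incl j.+2 p j.+1 q)
     \/ exists q, tabled c q /\ exists r, tabled (rcons c 1) r /\
       (exists u, arg 1 q u /\ arg 1 r u /\ forall x, arg 1 p x -> succ u x) /\
       share 0 q 2 r /\ incl 0 p 0 r /\
       forall j : 'I_n, incl j.+2 p j.+2 q /\ incl j.+2 p j.+3 r)
  (fsat M I (fPrimStep n c)).
Proof. denote. Qed.

Lemma fMinStepP I n c : reflect
  (forall p, tabled c p ->
     (exists q, tabled (rcons c 0) q /\ incl 0 p 1 q /\
        (forall j : 'I_n, incl j.+1 p j.+2 q) /\ exists u, arg 0 q u /\ zero u) /\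
     forall y, arg 0 p y -> forall z, num z -> nlt z y ->
       exists q, tabled (rcons c 0) q /\ arg 1 q z /\
         (forall j : 'I_n, incl j.+1 p j.+2 q) /\ exists u, arg 0 q u /\ ~ zero u)
  (fsat M I (fMinStep n c)).
Proof. denote. Qed.

End StepSemantics.

Lemma forall_ordS n (R : nat -> nat -> Prop) k (v : n.-tuple nat) :
  R 0 k -> (forall j : 'I_n, R j.+1 (tnth v j)) ->
  forall j : 'I_n.+1, R j (tnth [tuple of k :: v] j).
Proof.
move=> h0 hS j; case: (unliftP ord0 j) => [i ->|-> //].
by rewrite tnthS; apply: hS.
Qed.

(** * Soundness: every fact in a table is true *)

Section Soundness.
Variables (A : finType) (M : model A) (I0 : nat -> A).
Hypothesis ord : fsat M I0 fOrder.
Local Notation num := (num M).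
Local Notation nlt := (nlt M).
Local Notation arg := (arg M).

Let lt_irr x : num x -> nlt x x = false.
Proof. by move/fOrderP: ord => h /h[/negP/negbTE]. Qed.

Let lt_total x y : num x -> num y -> x != y -> nlt x y || nlt y x.
Proof.
move/fOrderP: ord => h /h[_ {}h] /h[{}h _] /eqP/h h'; exact/orP.
Qed.

Let lt_trans x y z : num x -> num y -> num z -> nlt x y -> nlt y z -> nlt x z.
Proof. by move/fOrderP: ord => h /h[_ {}h] /h[_ {}h] /h. Qed.

(** The natural number denoted by an element of the finite linear order: its rank. *)
Definition height x := #|[set z | num z && nlt z x]|.

Lemma zero_height x : zero M x = (height x == 0).
Proof.
rewrite cards_eq0; apply/forallP/eqP => [h|h z].
  by apply/setP => z; rewrite !inE; apply/negbTE; rewrite negb_and -implybE h.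
by have /setP/(_ z) := h; rewrite !inE implybE -negb_and => ->.
Qed.

Lemma height_lt x y : num x -> num y -> nlt x y -> height x < height y.
Proof.
move=> nx ny xy; apply: proper_card; apply/properP; split.
  apply/subsetP => z; rewrite !inE => /andP[nz zx].
  by rewrite nz (lt_trans nz nx ny zx xy).
by exists x; rewrite !inE nx ?xy // lt_irr.
Qed.

(** The numbers below [y] are those below [x] together with [x]. *)
Lemma height_succ x y : num x -> num y -> succ M x y -> height y = (height x).+1.
Proof.
move=> nx ny /andP[xy /forallP h].
have -> : height y = #|x |: [set z | num z && nlt z x]|.
  apply: eq_card => z; rewrite !inE.
  have := h z; have [->|_] := eqVneq z x; first by rewrite nx xy.
  case: (boolP (num z)) => //= nz; rewrite orbF.
  case: (boolP (nlt z x)) => [zx _|_]; last by case: (nlt z y).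
  exact: lt_trans zx xy.
by rewrite cardsU1 inE nx lt_irr.
Qed.

(** Ranks have no gaps: an element of greatest height below [y] is an immediate predecessor, and one
    descends from there. Minimization needs an element for every rank below its result. *)
Lemma height_below y k : num y -> k < height y ->
  exists z, [/\ num z, nlt z y & height z = k].
Proof.
have [b] := ubnP (height y); elim: b y => // b IHb y hb ny hk.
have [z0] : exists z, z \in [set z | num z && nlt z y].
  by apply/card_gt0P; apply: leq_ltn_trans hk.
rewrite inE => hz0; pose Q z := num z && nlt z y.
case: (@arg_maxnP _ z0 Q height hz0) => z /andP[nz zy] max_z.
have yz : height y = (height z).+1.
  apply: height_succ => //; apply/andP; split => //; apply/forallP => t.
  apply/implyP => nt; apply/implyP => ty.
  have [//|tz] := eqVneq t z; first by rewrite orbT.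
  case/orP: (lt_total nt nz tz) => [->//|zt].
  have ht : height t <= height z by apply: max_z; rewrite /Q nt ty.
  by move: ht; rewrite leqNgt height_lt.
have [zk|zk] := eqVneq (height z) k; first by exists z.
have [|//||t [nt tz tk]] := IHb z.
- by rewrite -ltnS -yz.
- by rewrite ltn_neqAle eq_sym zk -ltnS -yz.
by exists t; split=> //; apply: lt_trans tz zy.
Qed.

Definition reads p j k := exists2 x, arg j p x & height x = k.

Lemma arg_reads p j x : arg j p x -> reads p j (height x).
Proof. by exists x. Qed.

Lemma incl_reads i p j q k : incl M i p j q -> reads p i k -> reads q j k.
Proof. by move=> /forallP h [x hx <-]; exists x => //; apply: implyP hx. Qed.

Lemma share_reads i p j q : share M i p j q ->
  exists k, reads p i k /\ reads q j k.
Proof.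
by move=> /existsP[x /andP[/arg_reads hp /arg_reads hq]]; exists (height x).
Qed.

Lemma arg_num j p x : arg j p x -> num x.
Proof. by case/andP. Qed.

(** Induction on [f], with an inner induction on the recursion argument for [rPrim]: the facts
    justifying a fact provide the subcomputations. It applies to any numbers read off the entries,
    so entries need not be single-valued. *)
Lemma fTables_sound n (f : recf n) c I :
  fsat M I (fTables f c) -> forall p v y, tabled M c p ->
  (forall j : 'I_n, reads p j.+1 (tnth v j)) -> reads p 0 y -> computes f v y.
Proof.
elim: f c => {n} [n||n i|m n g IHg h IHh|n g IHg h IHh|n g IHg] c.
- move=> /fZeroStepP hs p v y hp _ [x /(hs p hp)].
  by rewrite zero_height => /eqP -> <-.
- move=> /fSuccStepP hs p v y hp hv [x hx <-].
  have [x' hx' ex'] := hv ord0.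
  have := hs p hp _ hx' _ hx.
  by move=> /(height_succ (arg_num hx') (arg_num hx)) /= ->; rewrite ex'.
- move=> /fProjStepP hs p v y hp hv [x hx <-].
  have [x' hx' ex'] := hv i.
  by rewrite /= -ex' (hs p hp _ hx' _ hx).
- rewrite [fTables _ _]/= !fsat_and fsat_bigand => /and3P[/fCompStepP hs hg /forallP hh].
  move=> p v y hp hv hy; have [r [hr [p0r hi]]] := hs p hp.
  have /fin_all_exists[w hw] : forall i : 'I_m, exists k,
      reads r i.+1 k /\ computes (h i) v k.
    move=> i; have [q [hq [pq]]] := hi i.
    move=> /share_reads[k [hk rk]]; exists k; split=> //.
    apply: (IHh i _ (hh i) q) => // j; exact: incl_reads (pq j) (hv j).
  exists [tuple w i | i < m]; split=> [i|].
    by rewrite tnth_mktuple; case: (hw i).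
  apply: (IHg _ hg r) => //; last exact: incl_reads hy.
  by move=> j; rewrite tnth_mktuple; case: (hw j).
- rewrite [fTables _ _]/= !fsat_and => /and3P[/fPrimStepP hs hg hh] p v.
  case/tupleP: v => k v; elim: k p => [|k IHk] p y hp hv hy;
    have [x hx xk] := hv ord0; rewrite -/(thead _) theadE in xk;
    (have hv' (j : 'I_n) : reads p j.+2 (tnth v j)
      by have := hv (lift ord0 j); rewrite tnthS);
    have [[zx [q [hq [pq0 pq]]]]|[q [hq [r [hr]]]]] := hs p hp.
  + apply/computes_prim0; apply: (IHg _ hg q) => //; last exact: incl_reads hy.
    by move=> j; apply: incl_reads (pq j) _.
  (* A recursion argument of rank 0 has no predecessor; the next case is the opposite
     contradiction. *)
  + move=> [[u [qu [_ ux]]] _].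
    by have := height_succ (arg_num qu) (arg_num hx) (ux _ hx); rewrite xk.
  + by have := zx _ hx; rewrite zero_height xk.
  + move=> [[u [qu [ru ux]]] [/share_reads[z [qz rz]] [pr0 pqr]]].
    have [uk] : k.+1 = (height u).+1.
      by rewrite -xk; apply: height_succ (arg_num qu) (arg_num hx) (ux _ hx).
    apply/computes_primS; exists z; split.
      apply: (IHk q) => //; apply: (@forall_ordS _ (fun j => reads q j.+1)).
        by rewrite uk; apply: arg_reads.
      by move=> j; case: (pqr j) => pqj _; apply: incl_reads pqj _.
    apply: (IHh _ hh r) => //; last exact: incl_reads hy.
    apply: (@forall_ordS _ (fun j => reads r j.+1)).
      by rewrite uk; apply: arg_reads.
    apply: (@forall_ordS _ (fun j => reads r j.+2)) => // j.
    by case: (pqr j) => _ prj; apply: incl_reads prj _.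
- rewrite [fTables _ _]/= !fsat_and => /andP[/fMinStepP hs hg] p v y hp hv hy.
  have [[q [hq [pq0 [pq [u [qu zu]]]]]] hlt] := hs p hp; split.
    apply: (IHg _ hg q) => //; last by exists u => //; apply/eqP; rewrite -zero_height.
    apply: (@forall_ordS _ (fun j => reads q j.+1)); first exact: incl_reads hy.
    by move=> j; apply: incl_reads (pq j) _.
  move=> k ky; have [x hx xy] := hy; rewrite -xy in ky.
  have [z [nz zx zk]] := height_below (arg_num hx) ky.
  have [r [hr [rz [pr [t [rt /negP zt]]]]]] := hlt _ hx _ nz zx.
  (* [rMin] asks for the nonzero value [height t] in successor form. *)
  exists (height t).-1; rewrite prednK; last by rewrite lt0n -zero_height.
  apply: (IHg _ hg r) => //; last exact: arg_reads.
  apply: (@forall_ordS _ (fun j => reads r j.+1)); first by rewrite -zk; apply: arg_reads.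
  by move=> j; apply: incl_reads (pr j) _.
Qed.
End Soundness.

(** * The grid of a terminating computation *)

(* The bound on all intermediate values makes the set of facts finite. *)
Fixpoint computes_le B n (f : recf n) : n.-tuple nat -> nat -> bool :=
  match f in recf n return n.-tuple nat -> nat -> bool with
  | rZero n => fun _ y => y == 0
  | rSucc => fun v y => y == (thead v).+1
  | rProj n i => fun v y => y == tnth v i
  | rComp m n g h => fun v y => [exists w : m.-tuple 'I_B.+1,
      [forall i, computes_le B (h i) v (tnth w i)] &&
      computes_le B g [tuple nat_of_ord (tnth w i) | i < m] y]
  | rPrim n g h => fun v =>
      nat_rect (fun=> nat -> bool) (computes_le B g [tuple of behead v])
        (fun k R y => [exists z : 'I_B.+1, R z &&
           computes_le B h [tuple of k :: nat_of_ord z :: [tuple of behead v]] y])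
        (thead v)
  | rMin n g => fun v y => computes_le B g [tuple of y :: v] 0 &&
      [forall z : 'I_y, exists t : 'I_B, computes_le B g [tuple of nat_of_ord z :: v] t.+1]
  end.

Lemma computes_le_prim0 B n (g : recf n) h (v : n.-tuple nat) y :
  computes_le B (rPrim g h) [tuple of 0 :: v] y = computes_le B g v y.
Proof. by rewrite /= [X in computes_le B g X y](_ : _ = v) //; apply: val_inj. Qed.

Lemma computes_le_primS B n (g : recf n) h k (v : n.-tuple nat) y :
  computes_le B (rPrim g h) [tuple of k.+1 :: v] y =
  [exists z : 'I_B.+1, computes_le B (rPrim g h) [tuple of k :: v] z &&
    computes_le B h [tuple of k :: nat_of_ord z :: v] y].
Proof.
have eb i : [tuple of behead (i :: v)] = v by apply: val_inj.
by rewrite /computes_le -/computes_le !theadE !eb.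
Qed.

(** Stated for all large bounds, so that the bounds of finitely many subcomputations combine by a
    maximum. *)
Lemma computes_le_eventually n (f : recf n) v y : computes f v y ->
  exists b, forall B, b <= B -> computes_le B f v y.
Proof.
elim: f v y => {n} [n||n i|m n g IHg h IHh|n g IHg h IHh|n g IHg] v y.
- by move=> /= ->; exists 0 => B _; apply: eqxx.
- by move=> /= ->; exists 0 => B _; apply: eqxx.
- by move=> /= ->; exists 0 => B _; apply: eqxx.
- move=> [w [hw /IHg[b hb]]].
  have /fin_all_exists[c hc] : forall i : 'I_m, exists c, forall B, c <= B ->
      computes_le B (h i) v (tnth w i) by move=> i; apply: IHh (hw i).
  (* The last maximum makes the intermediate values themselves fit into ['I_B.+1]. *)
  exists (maxn b (maxn (\max_i c i) (\max_i tnth w i))) => B.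
  rewrite !geq_max => /and3P[bB /bigmax_leqP cB /bigmax_leqP wB].
  pose w' : m.-tuple 'I_B.+1 := [tuple inord (tnth w i) | i < m].
  have hv i : tnth w' i = tnth w i :> nat.
    by rewrite tnth_mktuple inordK //; apply: (wB i isT).
  apply/existsP; exists w'; apply/andP; split.
    by apply/forallP => i; rewrite hv; apply: hc; apply: cB.
  have -> : [tuple nat_of_ord (tnth w' i) | i < m] = w; last exact: hb.
  by apply: eq_from_tnth => i; rewrite tnth_mktuple hv.
- case/tupleP: v => k v; elim: k y => [|k IHk] y.
    by move=> /computes_prim0/IHg[b hb]; exists b => B /hb; rewrite computes_le_prim0.
  move=> /computes_primS[z [/IHk[b hb] /IHh[c hc]]].
  exists (maxn z (maxn b c)) => B; rewrite !geq_max => /and3P[zB /hb h1 /hc h2].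
  rewrite computes_le_primS; apply/existsP; exists (inord z).
  by rewrite inordK // h1.
- move=> [/IHg[b hb] hz].
  have /fin_all_exists[t ht] : forall z : 'I_y, exists t,
      computes g [tuple of nat_of_ord z :: v] t.+1 by move=> z; apply: hz.
  have /fin_all_exists[c hc] : forall z : 'I_y, exists c, forall B, c <= B ->
      computes_le B g [tuple of nat_of_ord z :: v] (t z).+1 by move=> z; apply: IHg (ht z).
  (* The successor makes [t z] an element of ['I_B]. *)
  exists (maxn b (maxn (\max_z c z) (\max_z (t z).+1))) => B.
  rewrite !geq_max => /and3P[/hb h1 /bigmax_leqP cB /bigmax_leqP tB].
  rewrite /= h1; apply/forallP => z; apply/existsP.
  by exists (Ordinal (tB z isT)) => /=; apply: hc; apply: cB.
Qed.

(** A tuple length sufficient for the facts about all subterms: arity plus one entry for the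
    value. *)
Fixpoint width n (f : recf n) : nat :=
  match f with
  | rZero n => n.+1
  | rSucc => 2
  | rProj n _ => n.+1
  | rComp m n g h => maxn n.+1 (maxn (width g) (\max_(i < m) width (h i)))
  | rPrim n g h => maxn (width g) (width h)
  | rMin n g => width g
  end.

Lemma ltn_width n (f : recf n) : n < width f.
Proof.
elim: f => {n} //= [m n g _ h _|n g _ h IHh|n g IHg].
- by rewrite leq_max leqnn.
- by apply: leq_trans (leq_maxr _ _); apply: ltnW.
- exact: ltnW.
Qed.

(** Walks down the term along the path [c], with children numbered as in [fTables], and evaluates
    the subterm reached on the entries [l]. *)
Fixpoint fact B n (f : recf n) (c : seq nat) (l : nat -> nat) : bool :=
  match c with
  | [::] => computes_le B f [tuple l j.+1 | j < n] (l 0)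
  | i :: c' =>
    match f with
    | rComp m _ g h => if i is i'.+1
        then if insub i' is Some k then fact B (h k) c' l else false
        else fact B g c' l
    | rPrim _ g h => if i == 0 then fact B g c' l else fact B h c' l
    | rMin _ g => fact B g c' l
    | _ => false
    end
  end.

Lemma fact_nil B n (f : recf n) l :
  fact B f [::] l = computes_le B f [tuple l j.+1 | j < n] (l 0).
Proof. by case: f. Qed.

Section Grid.
Variables (F : recf 1) (B W : nat).

(** The set V of the grid: bounded numbers and tuples of entries. In V * V the diagonal represents V
    itself, and the point with coordinates v and w carries the relations from v to w. *)
Definition vertex := ('I_B.+1 + W.-tuple 'I_B.+1)%type.
Definition entry (t : W.-tuple 'I_B.+1) j : nat := nth ord0 t j.

(** Symbols from 2 on are decoded by parity: after subtracting 2, even ones are [arg_sym] and odd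
    ones [tab_sym]. *)
Definition grid_pred s (x : vertex * vertex) : bool :=
  match s, x with
  | 0, (inl a, inl b) => a == b
  | 1, (inl a, inl b) => a < b
  | s'.+2, (inr t, inl b) => ~~ odd s' && (entry t s'./2 == b)
  | s'.+2, (inr t, inr t') => [&& odd s', t == t' &
      if unpickle s'./2 is Some c then fact B F c (entry t) else false]
  | _, _ => false
  end.

Definition grid : model (vertex * vertex) := Model grid_pred
  (fun b x y => if b then x.2 == y.2 else x.1 == y.1).

Definition vnum (a : 'I_B.+1) : vertex * vertex := (inl a, inl a).
Definition vfact (t : W.-tuple 'I_B.+1) : vertex * vertex := (inr t, inr t).

(** In the grid the point required by a link is unique: its coordinates are [x.1] and [y.2]. *)
Lemma link_grid s x y : link grid s x y = grid_pred s (x.1, y.2).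
Proof.
apply/existsP/idP => [[[a b] /and3P[h /= /eqP <- /eqP <-]]|h] //.
by exists (x.1, y.2); rewrite /= h !eqxx.
Qed.

Lemma num_gridP x : reflect (exists a, x = vnum a) (num grid x).
Proof.
case: x => [[a|t] [b|t']]; apply: (iffP idP) => [|[] ? []] //.
- by move=> /eqP->; exists b.
- by move=> -> ->; apply: eqxx.
Qed.

Lemma num_vnum a : num grid (vnum a).
Proof. exact: eqxx. Qed.

Lemma nlt_vnum a b : nlt grid (vnum a) (vnum b) = (a < b).
Proof. by rewrite /nlt link_grid. Qed.

Lemma zero_vnum a : zero grid (vnum a) = (a == 0 :> nat).
Proof.
apply/forallP/eqP => [h|a0 z].
  have := h (vnum ord0); rewrite num_vnum nlt_vnum /= -eqn0Ngt.
  by move=> /eqP.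
by apply/implyP => /num_gridP[b ->]; rewrite nlt_vnum a0.
Qed.

Lemma succ_vnum (a b : 'I_B.+1) : b = a.+1 :> nat -> succ grid (vnum a) (vnum b).
Proof.
move=> ba; rewrite /succ nlt_vnum ba leqnn; apply/forallP => z.
apply/implyP => /num_gridP[c ->]; rewrite !nlt_vnum ba ltnS leq_eqVlt orbC.
by apply/implyP => /orP[->//|/eqP/val_inj->]; rewrite eqxx orbT.
Qed.

Lemma arg_vfact j t y :
  reflect (exists2 a, y = vnum a & entry t j = a) (arg grid j (vfact t) y).
Proof.
rewrite /arg link_grid /arg_sym; apply: (iffP andP).
  by move=> [/num_gridP[a ->]] /=; rewrite odd_double doubleK => /eqP; exists a.
by move=> [a -> e]; rewrite num_vnum /= odd_double doubleK e eqxx.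
Qed.

Lemma incl_vfact i t j t' :
  entry t i = entry t' j -> incl grid i (vfact t) j (vfact t').
Proof.
move=> e; apply/forallP => y; apply/implyP => /arg_vfact[a -> ea].
by apply/arg_vfact; exists a; rewrite // -e.
Qed.

Lemma arg_entry j t : arg grid j (vfact t) (vnum (nth ord0 t j)).
Proof. by apply/arg_vfact; exists (nth ord0 t j). Qed.

Lemma share_vfact i t j t' :
  entry t i = entry t' j -> share grid i (vfact t) j (vfact t').
Proof.
move=> e; apply/existsP; exists (vnum (nth ord0 t i)); rewrite arg_entry.
by apply/arg_vfact; exists (nth ord0 t i).
Qed.

Lemma grid_pred_tab c x : grid_pred (tab_sym c) x =
  if x is (inr t, inr t') then (t == t') && fact B F c (entry t) else false.
Proof.
have hp : ((pickle c).*2.+1)./2 = pickle c := half_bit_double _ true.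
case: x => [[a|t] [b|t']]; rewrite /grid_pred /tab_sym // oddS odd_double //.
by rewrite hp pickleK.
Qed.

Lemma tabled_gridP c x : reflect
  (exists2 t, x = vfact t & fact B F c (entry t)) (tabled grid c x).
Proof.
rewrite /tabled [mpred _]/= grid_pred_tab.
case: x => [[a|t] [b|t']]; apply: (iffP idP) => [|[u [] //]] //.
- by move=> /andP[/eqP <-]; exists t.
- by move=> <- ->; rewrite eqxx.
Qed.

Lemma fOrder_grid I : fsat grid I fOrder.
Proof.
apply/fOrderP => x /num_gridP[a ->]; rewrite nlt_vnum ltnn; split=> //.
move=> y /num_gridP[b ->]; rewrite !nlt_vnum; split=> [ab|z /num_gridP[c ->]].
  by case: (ltngtP a b) => [||/val_inj e]; [left|right|case: ab; rewrite e].
by rewrite !nlt_vnum; apply: ltn_trans.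
Qed.

(** The tuple lists [y] and [v], padded with zeros up to [W]; the bounds by [B] make [inord]
    exact. *)
Lemma make_fact n (v : n.-tuple nat) y : n < W -> y <= B ->
  (forall j, tnth v j <= B) ->
  exists t, [/\ entry t 0 = y, [tuple entry t j.+1 | j < n] = v
    & forall j : 'I_n, entry t j.+1 = tnth v j].
Proof.
move=> nW yB vB; pose t : W.-tuple 'I_B.+1 := [tuple inord (nth 0 (y :: v) j) | j < W].
have et j : j < W -> nth 0 (y :: v) j <= B -> entry t j = nth 0 (y :: v) j.
  move=> jW jB; rewrite /entry.
  by rewrite -[j in nth _ t j]/(val (Ordinal jW)) nth_mktuple inordK.
have ev (j : 'I_n) : entry t j.+1 = tnth v j.
  have evj : nth 0 (y :: v) j.+1 = tnth v j by rewrite (tnth_nth 0).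
  by rewrite et ?evj // (leq_ltn_trans _ nW).
exists t; split=> //; first by rewrite et // (leq_trans _ nW).
by apply: eq_from_tnth => j; rewrite tnth_mktuple ev.
Qed.

Lemma entry_le t j : entry t j <= B.
Proof. by rewrite -ltnS; apply: ltn_ord. Qed.

(** Converse of soundness, for the table of all bounded computations: witnesses in [computes_le]
    become the required facts. The hypothesis on [fact] says that [f] sits at position [c] of
    [F]. *)
Lemma fTables_grid I n (f : recf n) c : width f <= W ->
  (forall c' t, fact B F (c ++ c') (entry t) = fact B f c' (entry t)) ->
  fsat grid I (fTables f c).
Proof.
elim: f c => {n} [n||n i|m n g IHg h IHh|n g IHg h IHh|n g IHg] c wW hF;
  have hc t : fact B F c (entry t) = fact B _ [::] (entry t) := etrans
     (congr1 (fun c => fact B F c _) (esym (cats0 c))) (hF [::] t).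
- apply/fZeroStepP => p /tabled_gridP[t -> ]; rewrite hc => /eqP t0.
  by move=> y /arg_vfact[a -> e]; rewrite zero_vnum -e; apply/eqP.
- apply/fSuccStepP => p /tabled_gridP[t -> ]; rewrite hc => /eqP t0.
  move=> x /arg_vfact[a -> ea] y /arg_vfact[b -> eb].
  by apply: succ_vnum; rewrite -ea -eb t0 /thead tnth_mktuple.
- apply/fProjStepP => p /tabled_gridP[t -> ]; rewrite hc => /eqP t0.
  move=> x /arg_vfact[a -> ea] y /arg_vfact[b -> eb].
  congr vnum; apply: val_inj.
  by rewrite /= -ea -eb t0 tnth_mktuple.
- rewrite /= geq_max geq_max in wW.
  case/and3P: wW => nW gW /bigmax_leqP hW.
  rewrite [fTables _ _]/= !fsat_and fsat_bigand.
  have hg c' t : fact B F (rcons c 0 ++ c') (entry t) = fact B g c' (entry t).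
    by rewrite cat_rcons hF.
  have hh (i : 'I_m) c' t :
      fact B F (rcons c i.+1 ++ c') (entry t) = fact B (h i) c' (entry t).
    by rewrite cat_rcons hF /= valK.
  apply/and3P; split; [|exact: IHg|by apply/forallP => i; apply: IHh (hW i isT) _].
  apply/fCompStepP => p /tabled_gridP[t -> ]; rewrite hc.
  move=> /existsP[w /andP[/forallP hw gw]].
  have wB (i : 'I_m) : tnth [tuple nat_of_ord (tnth w i) | i < m] i <= B.
    by rewrite tnth_mktuple -ltnS ltn_ord.
  have [r [r0 rv rE]] := make_fact (leq_trans (ltn_width g) gW) (entry_le t 0) wB.
  exists (vfact r); split; [|split].
  + apply/tabled_gridP; exists r => //.
    by rewrite -[rcons c 0]cats0 hg fact_nil r0 rv.
  + exact: incl_vfact.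
  move=> i; have vB (j : 'I_n) : tnth [tuple entry t j.+1 | j < n] j <= B.
    by rewrite tnth_mktuple entry_le.
  have [q [q0 qv qE]] := make_fact nW (entry_le _ i.+1 : entry r i.+1 <= B) vB.
  exists (vfact q); split; [|split].
  + apply/tabled_gridP; exists q => //.
    by rewrite -[rcons c _]cats0 hh fact_nil q0 qv rE tnth_mktuple; apply: hw.
  + by move=> j; apply: incl_vfact; rewrite qE tnth_mktuple.
  + by apply: share_vfact; rewrite q0.
- rewrite /= geq_max in wW; case/andP: wW => gW hW.
  rewrite [fTables _ _]/= !fsat_and.
  have hg c' t : fact B F (rcons c 0 ++ c') (entry t) = fact B g c' (entry t).
    by rewrite cat_rcons hF.
  have hh c' t : fact B F (rcons c 1 ++ c') (entry t) = fact B h c' (entry t).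
    by rewrite cat_rcons hF.
  apply/and3P; split; [|exact: IHg|exact: IHh].
  apply/fPrimStepP => p /tabled_gridP[t -> ]; rewrite hc fact_nil.
  pose v := [tuple entry t j.+2 | j < n].
  have vE (j : 'I_n) : entry t j.+2 = tnth v j by rewrite tnth_mktuple.
  have vB (j : 'I_n) : tnth v j <= B by rewrite -vE entry_le.
  have -> : [tuple entry t j.+1 | j < n.+1] = [tuple of entry t 1 :: v].
    apply: eq_from_tnth => i; rewrite tnth_mktuple.
    by case: (unliftP ord0 i) => [j ->|->] //; rewrite tnthS -vE.
  case e1: (entry t 1) => [|k].
    rewrite computes_le_prim0 => gv; left; split.
      by move=> x /arg_vfact[a -> ea]; rewrite zero_vnum -ea e1.
    have [q [q0 qv qE]] := make_fact (leq_trans (ltn_width g) gW) (entry_le t 0) vB.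
    exists (vfact q); split; [|split].
    + apply/tabled_gridP; exists q => //.
      by rewrite -[rcons c 0]cats0 hg fact_nil q0 qv.
    + exact: incl_vfact.
    + by move=> j; apply: incl_vfact; rewrite qE vE.
  rewrite computes_le_primS => /existsP[z /andP[hz hy]]; right.
  have kB : k <= B by apply: leq_trans (leqnSn k) _; rewrite -e1 entry_le.
  have zB : z <= B by rewrite -ltnS.
  have n2W := leq_trans (ltn_width h) hW.
  (* [q] records the previous stage of the recursion, at the same position, and [r] the application
     of the step function. *)
  have [|q [q0 qv qE]] := @make_fact _ [tuple of k :: v] z (ltnW n2W) zB.
    exact: (@forall_ordS _ (fun _ x => x <= B)).
  have [|r [r0 rv rE]] := @make_fact _ [tuple of k :: nat_of_ord z :: v] _ n2W (entry_le t 0).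
    apply: (@forall_ordS _ (fun _ x => x <= B)) => //.
    exact: (@forall_ordS _ (fun _ x => x <= B)).
  have q1 : entry q 1 = k by rewrite (qE ord0).
  have r1 : entry r 1 = k by rewrite (rE ord0).
  have r2 : entry r 2 = z by rewrite (rE (lift ord0 ord0)).
  exists (vfact q); split.
    apply/tabled_gridP; exists q => //.
    by rewrite hc fact_nil q0 qv.
  exists (vfact r); split.
    apply/tabled_gridP; exists r => //.
    by rewrite -[rcons c _]cats0 hh fact_nil r0 rv.
  split.
    exists (vnum (nth ord0 q 1)); rewrite arg_entry; split=> //; split.
      by apply/arg_vfact; exists (nth ord0 q 1) => //; rewrite r1 -q1.
    move=> x /arg_vfact[a -> ea]; apply: succ_vnum.
    by rewrite -ea e1 -q1.
  split; first by apply: share_vfact; rewrite q0 r2.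
  split; first exact: incl_vfact.
  move=> j; split; apply: incl_vfact; rewrite vE.
    by rewrite (qE (lift ord0 j)) tnthS.
  by rewrite (rE (lift ord0 (lift ord0 j))) !tnthS.
- rewrite /= in wW; rewrite [fTables _ _]/= !fsat_and.
  have hg c' t : fact B F (rcons c 0 ++ c') (entry t) = fact B g c' (entry t).
    by rewrite cat_rcons hF.
  apply/andP; split; last exact: IHg.
  apply/fMinStepP => p /tabled_gridP[t -> ]; rewrite hc.
  move=> /andP[gt /forallP hlt]; pose v := [tuple entry t j.+1 | j < n].
  have vE (j : 'I_n) : entry t j.+1 = tnth v j by rewrite tnth_mktuple.
  have vB (j : 'I_n) : tnth v j <= B by rewrite -vE entry_le.
  have nW := leq_trans (ltn_width g) wW.
  (* Used for the result itself, with value 0, and for each smaller candidate, with a positive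
     value. *)
  have find z y : z <= B -> y <= B -> computes_le B g [tuple of z :: v] y ->
      exists q, [/\ tabled grid (rcons c 0) (vfact q), entry q 0 = y, entry q 1 = z
        & forall j : 'I_n, incl grid j.+1 (vfact t) j.+2 (vfact q)].
    move=> zB yB gz.
    have [|q [q0 qv qE]] := @make_fact _ [tuple of z :: v] _ nW yB.
      exact: (@forall_ordS _ (fun _ x => x <= B)).
    exists q; split=> //; last 2 first.
    + by rewrite (qE ord0).
    + by move=> j; apply: incl_vfact; rewrite vE (qE (lift ord0 j)) tnthS.
    apply/tabled_gridP; exists q => //.
    by rewrite -[rcons c 0]cats0 hg fact_nil q0 qv.
  split.
    have [q [hq q0 q1 hi]] := find _ _ (entry_le t 0) (leq0n B) gt.
    exists (vfact q); split=> //; split; first exact: incl_vfact.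
    split=> //; exists (vnum (nth ord0 q 0)); rewrite arg_entry zero_vnum.
    by split=> //; apply/eqP.
  move=> y /arg_vfact[a -> ea] z /num_gridP[b ->]; rewrite nlt_vnum -ea => ba.
  have /existsP[u hu] := hlt (Ordinal ba).
  have [||q [hq q0 q1 hi]] := find b u.+1 _ _ hu => //.
    by rewrite -ltnS.
  exists (vfact q); split=> //; split; first by apply/arg_vfact; exists b.
  split=> //; exists (vnum (nth ord0 q 0)); rewrite arg_entry zero_vnum.
  by split=> //; apply/negP; rewrite -[nat_of_ord _]/(entry q 0) q0.
Qed.
End Grid.

(** * Diagonalization *)

Lemma fvin_tables n (f : recf n) c : fvin [:: 0] (fTables f c).
Proof.
elim: f c => {n} [n||n i|m n g IHg h IHh|n g IHg h IHh|n g IHg] c //;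
  rewrite [fTables _ _]/= !fvin_and ?fvin_bigand.
- apply/and3P; split; [|exact: IHg|by apply/forallP => i; apply: IHh].
  rewrite /= !fvin_bigand; apply/forallP => i /=.
  by rewrite fvin_bigand andbT; apply/forallP.
- rewrite IHg IHh andbT /= !fvin_bigand.
  by rewrite !(introT forallP).
- rewrite IHg andbT /= !fvin_bigand.
  by rewrite !(introT forallP).
Qed.

(** Variable 0 is rebound to the predecessor through [fEq 0 1], so that every step has the same
    shape and the code is obtained by iterating one function on codes. *)
Fixpoint fIs k : form :=
  if k is k'.+1 then fEx 1 (fAnd (fAnd (fNum 1) (fSucc 1 0))
                                 (fEx 0 (fAnd (fEq 0 1) (fIs k'))))
  else fZero 0.

Lemma fvin_is k s : 0 \in s -> fvin s (fIs k).
Proof.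
elim: k s => [|k IHk] s hs /=; first by rewrite !inE hs.
by rewrite !inE hs IHk ?inE //= ?orbT.
Qed.

Lemma fIs_sound (A : finType) (M : model A) I0 I k :
  fsat M I0 fOrder -> num M (I 0) -> fsat M I (fIs k) -> height M (I 0) = k.
Proof.
move=> ord; elim: k I => [|k IHk] I n0.
  by rewrite fsat_zero zero_height => /eqP.
rewrite [fIs _]/= fsat_ex => /existsP[a]; rewrite 2!fsat_and fsat_succ fsat_ex.
move=> /andP[/andP[na a0] /existsP[b]]; rewrite fsat_and => /andP[/eqP ba hb].
have {}ba : b = a := ba.
by rewrite (height_succ ord na n0 a0) -(IHk _ _ hb) ba.
Qed.

Lemma fIs_grid F B W I (a : 'I_B.+1) :
  I 0 = vnum W a -> fsat (grid F B W) I (fIs a).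
Proof.
(* Induction on the value of [a], with the ordinal generalized and tied to it by an equation. *)
elim: {a}(nat_of_ord a) {1 3}a (erefl (nat_of_ord a)) I => [|k IHk] a ak I Ia.
  by rewrite fsat_zero Ia zero_vnum ak.
have kB : k < B.+1 by rewrite -ltnS -ak ltnW // ltnS ltn_ord.
rewrite [fIs _]/= fsat_ex; apply/existsP; exists (vnum W (Ordinal kB)).
rewrite 2!fsat_and fsat_succ fsat_ex; apply/andP; split.
  by rewrite /= Ia succ_vnum // andbT; apply: num_vnum.
apply/existsP; exists (vnum W (Ordinal kB)).
rewrite fsat_and; apply/andP; split; first exact: eqxx.
exact: (IHk (Ordinal kB)).
Qed.

(** The template: its input is the free variable 0, so that in [fHaltsOn] only the conjunct [fIs k]
    depends on [k]. *)
Definition fHalts (F : recf 1) : form :=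
  fAnd fOrder (fAnd (fTables F [::]) (fEx 1 (fAnd (fTab [::] 1)
    (fAnd (fArg 1 1 0) (fEx 2 (fAnd (fArg 0 1 2) (fZero 2))))))).

Definition fHaltsOn F k : form := fEx 0 (fAnd (fHalts F) (fIs k)).

Lemma fvin_haltsOn F k : fvin [::] (fHaltsOn F k).
Proof. by rewrite /= fvin_tables fvin_is. Qed.

Lemma fHaltsOn_sound F k (A : finType) (M : model A) I :
  fsat M I (fHaltsOn F k) -> computes F [tuple k] 0.
Proof.
rewrite fsat_ex => /existsP[a]; rewrite !fsat_and => /andP[/and3P[ord tabs]].
rewrite fsat_ex => /existsP[p]; rewrite 2!fsat_and fsat_arg fsat_ex.
move=> /and3P[hp pa /existsP[u]]; rewrite fsat_and fsat_arg fsat_zero.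
move=> /andP[pu zu] hk.
apply: (fTables_sound ord tabs hp).
  move=> j; rewrite ord1; exists a => //.
  by apply: (fIs_sound ord _ hk); apply: arg_num pa.
by exists u => //; apply/eqP; rewrite -zero_height.
Qed.

Lemma fHaltsOn_grid F k : computes F [tuple k] 0 ->
  exists B W, forall I, fsat (grid F B W) I (fHaltsOn F k).
Proof.
(* The bound also covers the input [k], which has to be a number of the grid. *)
move=> /computes_le_eventually[b hb]; exists (maxn b k), (width F) => I.
set B := maxn b k; pose a : 'I_B.+1 := inord k.
have ak : a = k :> nat by rewrite inordK // ltnS leq_maxr.
rewrite fsat_ex; apply/existsP; exists (vnum _ a).
rewrite !fsat_and -{1}ak fIs_grid // andbT fOrder_grid fTables_grid // !andTb.
have [|t [t0 tv tE]] := @make_fact B _ _ [tuple k] 0 (ltn_width F) (leq0n _).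
  by move=> j; rewrite ord1 leq_maxr.
rewrite fsat_ex; apply/existsP; exists (vfact t).
rewrite 2!fsat_and fsat_arg fsat_ex; apply/and3P; split.
- apply/(@tabled_gridP F _ _ [::] (vfact t)); exists t => //.
  by rewrite fact_nil t0 tv; apply: hb; apply: leq_maxl.
- by apply/arg_vfact; exists a; rewrite // ak (tE ord0).
apply/existsP; exists (vnum _ ord0); rewrite fsat_and fsat_arg fsat_zero.
by rewrite zero_vnum andbT; apply/arg_vfact; exists ord0.
Qed.

(** * Views of radius three in a grid *)

Section FullView.
Variables (K : nat) (V : finType) (P : nat -> V * V -> bool).

Definition grid_data : data 2 'I_K.+1 (V * V)%type :=
  Data (fun s : 'I_K.+1 => [set x | P s x])
       (fun i (x : V * V) => nat_of_ord (enum_rank (if i == ord0 then x.1 else x.2))).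

(* The path moves along the row or column of [x], switches coordinate, and moves
   along the column or row of [v]. *)
Lemma ball_grid x v : v \in ball diag_rel grid_data 3 x.
Proof.
case: v => y i; rewrite inE; pose i' : 'I_2 := if i == ord0 then ord_max else ord0.
pose z := if i == ord0 then (y.1, x.2) else (x.1, y.2).
have hi (j : 'I_2) : (j, j) \in diag_rel.
  have -> : j = ord_of_bool (j != ord0) by case: j => [[|[|//]] ?]; apply: val_inj.
  exact: diag_relP.
apply/existsP; exists i'; apply/existsP; exists ord_max.
apply/existsP; exists [tuple (z, i'); (z, i); (y, i)].
rewrite /= /data_edge /= !hi !eqxx /= andbT /z /i'.
by case: (eqVneq i ord0) => [->|ni]; rewrite /= ?eqxx ?orbT // eq_sym ni.
Qed.

Lemma view_dom_grid x y : y \in view_dom diag_rel grid_data 3 x.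
Proof. by rewrite inE; apply/existsP; exists ord0; apply: ball_grid. Qed.

(** By [ball_grid] the view keeps all points with their original values, so [val] is an isomorphism
    onto the grid. *)
Lemma fsat_view_grid x I (I' : nat -> V * V) p : fcode p <= K ->
  (forall y, val (I y) = I' y) ->
  fsat (model_of (view diag_rel grid_data 3 x)) I p =
  fsat (Model P (fun b u v => if b then u.2 == v.2 else u.1 == v.1)) I' p.
Proof.
move=> pK hI; apply: (fsat_iso (h := val) (K := K)) => //.
- exists (fun y => Sub y (view_dom_grid x y)) => y; last by rewrite SubK.
  by apply: val_inj; rewrite SubK.
- by move=> s y sK; rewrite /= !inE inordK.
- move=> b u v; rewrite /= !ball_grid.
  by case: b; rewrite /= (inj_eq val_inj) (inj_eq enum_rank_inj).
Qed.
End FullView.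

Lemma closed_dfv x K p : fvin [::] p -> all (pred1 x) (dfv (to_dFO K p)).
Proof. by move=> /(dfv_to_dFO K); apply: sub_all => y. Qed.

(** The signature has [(fcode p).+1] symbols: enough for [p], and such that the code of the instance
    depends only on [fcode p]. *)
Definition inst_of (p : form) (hp : fvin [::] p) : instance diag_rel 3 :=
  Instance (sentence := eEx 0 (eLoc 3 (closed_dfv 0 (fcode p) hp))) isT.

Definition inst_code c :=
  cpair c.+1 (cpair 3 (cpair 0 (cpair 0 (cpair 0 c)))).

Lemma icode_inst p (hp : fvin [::] p) : icode (inst_of hp) = inst_code (fcode p).
Proof. by rewrite /icode /= dcode_to_dFO. Qed.

(** Soundness holds in every model, hence in the view provided by any solution; conversely, a
    terminating computation gives a grid whose views are the whole grid. *)
Lemma DataSat_inst F k : DataSat (inst_of (fvin_haltsOn F k)) <->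
  computes F [tuple k] 0.
Proof.
split=> [[A [str [/card_gt0P[a _] /(_ (fun=> a))]]]|].
  move=> /existsP[b /existsP[u /andP[_]]].
  by rewrite dsat_to_dFO; apply: fHaltsOn_sound.
move=> /fHaltsOn_grid[B [W hBW]]; set p := fHaltsOn F k in hBW *.
pose x := @vnum B W ord0; pose P := @grid_pred F B W.
exists _, (grid_data (fcode p) P).
split=> [|I]; first by apply/card_gt0P; exists x.
apply/existsP; exists x; apply/existsP.
exists (Sub x (view_dom_grid (fcode p) P x x)).
rewrite SubK eqxx dsat_to_dFO.
rewrite (fsat_view_grid (leqnn _) (fun y => erefl)).
exact: hBW.
Qed.

(** * Recursiveness of the diagonal substitution *)

Definition codeAnd a b := cpair 4 (cpair 3 (cpair (cpair 4 a) (cpair 4 b))).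

Definition fIs_step c :=
  cpair 5 (cpair 1 (codeAnd (fcode (fAnd (fNum 1) (fSucc 1 0)))
    (cpair 5 (cpair 0 (codeAnd (fcode (fEq 0 1)) c))))).

(* The codes of fixed formulas are huge unary numbers: never evaluate them. *)
Local Opaque cpair.

Lemma fcode_is k : fcode (fIs k) =
  nat_rect (fun=> nat) (fcode (fZero 0)) (fun _ => fIs_step) k.
Proof. by elim: k => //= k <-. Qed.

(** [n] occurs both as the code of the template and as the input described by [fIs n]. *)
Definition diag_code n := inst_code (cpair 5 (cpair 0 (codeAnd n (fcode (fIs n))))).

Definition rPairs n (a b : recf n) : recf n := rComp2 rPair a b.
Definition rCodeAnd n (a b : recf n) := rPairs (rConst n 4) (rPairs (rConst n 3)
  (rPairs (rPairs (rConst n 4) a) (rPairs (rConst n 4) b))).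

Lemma represents_codeAnd n (a b : recf n) F F' :
  represents a F -> represents b F' ->
  represents (rCodeAnd a b) (fun v => codeAnd (F v) (F' v)).
Proof.
move=> ha hb; apply: represents_cpair (represents_const 4) _.
apply: represents_cpair (represents_const 3) _.
by apply: represents_cpair; apply: represents_cpair (represents_const 4) _.
Qed.

(** The programs left open by [eexists] are synthesized by the [represents] lemmas, following the
    expression for the code; [fIs] contributes the only recursion outside pairing. *)
Lemma diag_code_recursive : exists s : recf 1,
  forall n y, computes s [tuple n] y <-> y = diag_code n.
Proof.
pose k0 : recf 0 := rConst 0 (fcode (fZero 0)).
have const m c := @represents_const m c.
have step : exists r : recf 2, represents r (fun v => fIs_step (tnth v ord_max)).
  eexists; apply: represents_cpair (const _ 5) _; apply: represents_cpair (const _ 1) _.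
  apply: represents_codeAnd (const _ _) _.
  apply: represents_cpair (const _ 5) _; apply: represents_cpair (const _ 0) _.
  apply: represents_codeAnd (const _ _) _; exact: represents_proj.
have [r hr] := step.
have is_rec : represents (rPrim k0 r) (fun v => fcode (fIs (thead v))).
  case/tupleP=> k v y; rewrite (tuple0 v) theadE fcode_is.
  exact: represents_prim (const _ _) hr _ _ _.
have total : exists s : recf 1, represents s (fun v => diag_code (thead v)).
  have body : exists s : recf 1, represents s (fun v =>
      cpair 5 (cpair 0 (codeAnd (thead v) (fcode (fIs (thead v)))))).
    eexists; apply: represents_cpair (const _ 5) _; apply: represents_cpair (const _ 0) _.
    by apply: represents_codeAnd is_rec; apply: (represents_proj ord0).
  have [s hs] := body; eexists; apply: represents_cpair.
    exact: represents_comp1 represents_succ hs.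
  do 3?[apply: represents_cpair (const _ _) _].
  by apply: represents_cpair (const _ _) hs.
have [s hs] := total; exists s => n y; rewrite hs.
by rewrite theadE.
Qed.

Theorem theorem4p13 :
  let Gamma : {set 'I_2 * 'I_2} := [set (ord0, ord0); (ord_max, ord_max)] in
  undecidable (@icode 2 Gamma 3) (@DataSat 2 Gamma 3).
Proof.
move=> Gamma [f decf]; have [s hs] := diag_code_recursive.
pose F := rComp1 f s; pose n := fcode (fHalts F).
pose inst := inst_of (fvin_haltsOn F n).
have codeE : icode inst = diag_code n by rewrite icode_inst.
have haltsE : computes F [tuple n] 0 <-> computes f [tuple icode inst] 0.
  apply: computes_comp1 => z; rewrite codeE; exact: hs.
have [yes no] := decf inst.
(* Satisfiability would make [f] answer 1 as a decision procedure and 0 by the meaning of the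
   instance. Being unsatisfiable, the instance gets the answer 0, which makes it satisfiable. *)
have unsat : ~ DataSat inst.
  move=> sat; have /haltsE f0 := proj1 (DataSat_inst F n) sat.
  by have := computes_functional (yes sat) f0.
exact: unsat (proj2 (DataSat_inst F n) (proj2 haltsE (no unsat))).
Qed.
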